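(* Let $(S,\varphi,\mathbf a)$ be an open book diagram whose Heegaard diagram $(\Sigma,\boldsymbol\beta,\boldsymbol\alpha,\mathbf z)$ is nice, and regard $\partial_0,\partial_1$ as maps $C_1\to C_0$. Assume that $\partial_1:C_1\to C_0$ is injective and that $\partial_0:C_1\to C_0$ is not injective. Let $U_0=\partial_1(C_1)\subset C_0$ and $\delta=\partial_0\circ\partial_1^{-1}:U_0\to C_0$; for $i\geq1$ let $U_i=\delta^{-1}(U_{i-1})$, let $\delta_i=\delta|_{U_i}:U_i\to U_{i-1}$, and let $$\delta^i=\delta\circ\delta_1\circ\cdots\circ\delta_{i-1}:U_{i-1}\to C_0 .$$ Let $m\geq1$ be such that $\ker\delta^i\subset\ker\delta^m$ for all $i\geq1$ (such an $m$ exists), and let $\mathcal R=\mathbf x_\xi+\partial_0(C_1)\subset C_0$. Then $o(S,\varphi,\mathbf a)<\infty$ if and only if $\ker\delta^m\cap\mathcal R\neq\emptyset$.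
   Context: An open book diagram $(S,\varphi,\mathbf a)$ consists of an abstract open book $(S,\varphi)$ and a collection $\mathbf a=\{a_1,\dots,a_N\}$ of pairwise disjoint, properly embedded oriented arcs on $S$ cutting it open into a disjoint union of disks. It yields a weakly admissible (multi-)pointed Heegaard diagram $(\Sigma,\boldsymbol\beta,\boldsymbol\alpha,\mathbf z)$: $\Sigma=S_{1/2}\cup_{\partial S}-S_0$ (two copies of $S$); $\alpha_i=a_i\cup-a_i$; $\beta_i=b_i\cup-\varphi(b_i)$ with $b_i$ a Hamiltonian isotopic copy of $a_i$ intersecting $a_i$ positively in one distinguished point $x_\xi^i\in\mathrm{int}(S_{1/2})$; and $\mathbf z$ has one point $z_j$ in the interior of each connected component of $S_{1/2}\setminus\bigcup_i a_i$, outside the thin strips between $a_i$ and $b_i$. Regions are the closures of the subsurfaces into which the curves divide $\Sigma$; a region is unpointed if it contains no $z_j$. The diagram is nice if all unpointed regions are bigons or rectangles. A generator is a set of $N$ intersection points determining a one-to-one pairing between $\boldsymbol\alpha$- and $\boldsymbol\beta$-curves. For generators $\mathbf x,\mathbf y$, $\widehat\pi_2(\mathbf x,\mathbf y)$ is the set of domains, i.e. integer linear combinations $D$ of unpointed regions with $\partial(\partial|_{\boldsymbol\beta}D)=\mathbf y-\mathbf x$. The canonical generator is $\mathbf x_\xi=\{x_\xi^1,\dots,x_\xi^N\}$. For $D\in\widehat\pi_2(\mathbf x,\mathbf y)$ define $J_+(D)=\mu(D)-2e(D)+|\mathbf x|-|\mathbf y|$, where $|\cdot|$ is the number of disjoint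 cycles in the element of the symmetric group $\mathrm S_N$ determined by the pairing associated to a generator ($|\mathbf x_\xi|=N$); $e(D)$ is the Euler measure (additive, equal to Euler characteristic minus one quarter of the number of corners on each region); and $\mu(D)=n_{\mathbf x}(D)+n_{\mathbf y}(D)+e(D)$ is the Maslov index, with $n_{\mathbf x}(D)$ the sum over the points $x_i$ of $\mathbf x$ of the average of the coefficients of $D$ in the four regions with corners at $x_i$. Let $\mathbb F=\mathbb Z/2\mathbb Z$, let $\widehat{CF}(\Sigma,\boldsymbol\beta,\boldsymbol\alpha)$ be the hat Heegaard Floer chain complex over $\mathbb F$ freely generated by the generators, with differential $\widehat\partial_{HF}$ counting index-1 holomorphic curves modulo 2, and let $\widehat{CF}(\Sigma,\boldsymbol\beta,\boldsymbol\alpha,\mathfrak s_\xi)$ be its summand in the Spin$^c$ structure $\mathfrak s_\xi$ of $\mathbf x_\xi$. For $\ell\ge0$ let $\partial_\ell$ be the part of $\widehat\partial_{HF}$ counting curves in domains with $J_+=2\ell$. For nice diagrams it is known that the Maslov index-1 positive domains are exactly empty embedded bigons and empty embedded rectangles, each with a single holomorphic representative, that $\widehat\partial_{HF}=\partial_0+\partial_1$, and that $\partial_0,\partial_1$ are differentials with $\partial_0\partial_1=\partial_1\partial_0$. $C_0$ and $C_1$ denote the subspaces of chains in $\widehat{CF}(\Sigma,\boldsymbol\beta,\boldsymbol\alpha,\mathfrak s_\xi)$ in the same relative Maslov grading as $\mathbf x_\xi$, respectively in relative Maslov grading one above $\mathbf x_\xi$ (the relative grading being $\mu$ of a connecting domain,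 modulo the divisibility of $\mathfrak s_\xi$). Both are finite dimensional. $o(S,\varphi,\mathbf a)\in\mathbb N\cup\{\infty\}$ is the smallest $k\ge0$ such that $\mathbf x_\xi$ represents the trivial class in the $(k+1)$-st page $E^{k+1}$ of the spectral sequence of the complex $\widehat{CF}(\Sigma,\boldsymbol\beta,\boldsymbol\alpha)\otimes_{\mathbb F}\mathbb F[t,t^{-1}]$ with differential $\sum_{\ell\ge0}\partial_\ell\otimes t^{-\ell}$, filtered by the power of $t$ ($E^1$ is the homology of the associated graded complex); it is $\infty$ if there is no such $k$. *)

(* Defs.v *)
(* MathComp, with the classical layer of MathComp-Analysis for the few
   non-decidable notions (infinite sets of domains, least pages). *)
From HB Require Import structures.
From mathcomp Require Import all_boot all_order all_fingroup all_algebra.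
From mathcomp Require Import finmap.
From mathcomp Require Import mathcomp_extra boolp classical_sets functions.
From mathcomp Require Import cardinality fsbigop.

Set Implicit Arguments.
Unset Strict Implicit.
Unset Printing Implicit Defensive.

Import Order.TTheory GRing.Theory Num.Theory.
Local Open Scope ring_scope.

(** * Open book diagrams *)

(* Surfaces with transverse systems of arcs are recorded by their
   combinatorial type, i.e. up to orientation preserving homeomorphism.

   The pair (S, a).  The end of the arc a_i at which it starts is (i, false),
   the end at which it stops is (i, true).  Since the arcs cut S into disks,
   (S, a) is determined by the permutation [bnext] sending an end to the next
   one met along the oriented boundary of S; every permutation occurs, S being
   recovered by gluing one polygon to each cycle of boundary segments and arc
   sides.  (Components of S that are disks without arcs are left out; they
   contribute no curve and no unpointed region.)

   The monodromy.  b_i is a_i with both ends pushed slightly along the oriented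
   boundary, so that a_i and b_i meet once, with a_i . b_i = +1, and the end of
   b_i corresponding to e lies right after e.  The monodromy phi is recorded by
   the arcs phi(b_i), assumed transverse to the a_j: they have the same ends as
   the b_i, and are cut by the a_j into chords of the polygons.
   By Alexander's trick a system of disjoint arcs c_i with the ends of the b_i is
   the image of the b_i under a homeomorphism of S fixing the boundary, unique up
   to isotopy fixing the arcs: the components of S minus the c_i are disks
   because they have the same boundary circuits and the same total Euler
   characteristic as those of S minus the b_i. *)

Section Polygons.
Variables (N : nat) (bnext : {perm 'I_N * bool}) (X : finType).
Variables (aword cword : 'I_N -> seq X) (on_a : X -> 'I_N) (csign : X -> bool).

(* The ends of the chords, on the boundary of the polygons: [inl e] is the end
   of b (and of phi(b)) next to e, [inr (x, true)] and [inr (x, false)] are the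
   crossing x seen from the left and from the right of the arc a through it. *)
Definition chord_end : finType := ('I_N * bool + X * bool)%type.

(* The chord ends met when walking along a side of a_i, from its end f = (i, _),
   with the polygon on the left, until the first one past the other end. *)
Definition side_walk (f : 'I_N * bool) : seq chord_end :=
  rcons [seq inr (x, ~~ f.2) | x <- if f.2 then rev (aword f.1) else aword f.1]
        (inl (f.1, ~~ f.2)).

(* The next chord end on the counterclockwise boundary of a polygon. *)
Definition polygon_next (t : chord_end) : chord_end :=
  match t with
  | inl e => head t (side_walk (bnext e))
  | inr (x, s) => next (side_walk (on_a x, ~~ s)) t
  end.

(* The successive chords of phi(b_j), as pairs (origin, target).  At a crossing
   with a . phi(b) = +1, phi(b) passes from the right to the left of a. *)
Definition chords_of (j : 'I_N) : seq (chord_end * chord_end) :=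
  zip (inl (j, false) :: [seq inr (x, csign x) | x <- cword j])
      (rcons [seq inr (x, ~~ csign x) | x <- cword j] (inl (j, true))).

Definition is_chord (c : chord_end * chord_end) : bool :=
  [exists j, c \in chords_of j].

Definition same_polygon (t u : chord_end) : bool := fconnect polygon_next t u.

Definition inside (c : chord_end * chord_end) (t : chord_end) : bool :=
  (findex polygon_next c.1 t < findex polygon_next c.1 c.2)%N.

Definition disjoint_chords : Prop :=
  (forall c, is_chord c -> same_polygon c.1 c.2) /\
  (forall c d, is_chord c -> is_chord d -> d <> c ->
     same_polygon c.1 d.1 -> inside c d.1 = inside c d.2).

End Polygons.

Record open_book_diagram := OpenBookDiagram {
  narcs : nat;
  bnext : {perm 'I_narcs * bool};
  (* the intersection points of the a_i with the phi(b_j) in S *)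
  crossing : finType;
  (* those on a_i, and those on phi(b_j), in the order of the oriented arc *)
  aword : 'I_narcs -> seq crossing;
  cword : 'I_narcs -> seq crossing;
  on_a : crossing -> 'I_narcs;
  on_c : crossing -> 'I_narcs;
  (* true when a . phi(b) = +1 for the orientation of S *)
  csign : crossing -> bool;
  awordE : forall i x, (x \in aword i) = (on_a x == i);
  cwordE : forall j x, (x \in cword j) = (on_c x == j);
  aword_uniq : forall i, uniq (aword i);
  cword_uniq : forall j, uniq (cword j);
  chordsP : disjoint_chords bnext aword cword on_a csign
}.

(** * Heegaard diagrams *)

(* A quadrant (p, oa, ob) is one of the four sectors at the intersection point
   p of an alpha- and a beta-curve: its sides are the outgoing (oa = true) or
   incoming (oa = false) alpha-edge, and the outgoing or incoming beta-edge. *)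
Definition quadrant (X : finType) : finType := (X * bool * bool)%type.

(* Every alpha- and beta-curve is an oriented cyclic word in the intersection
   points.  [hsign p] is true when alpha . beta = +1 at p.  [pointed] selects
   quadrants lying in regions that contain a base point, at least one on each
   boundary circle of such a region. *)
Record heegaard_diagram := HeegaardDiagram {
  ncurves : nat;
  pt : finType;
  alpha : 'I_ncurves -> seq pt;
  beta : 'I_ncurves -> seq pt;
  on_alpha : pt -> 'I_ncurves;
  on_beta : pt -> 'I_ncurves;
  hsign : pt -> bool;
  pointed : {set quadrant pt};
  alphaE : forall i p, (p \in alpha i) = (on_alpha p == i);
  betaE : forall j p, (p \in beta j) = (on_beta p == j);
  alpha_uniq : forall i, uniq (alpha i);
  beta_uniq : forall j, uniq (beta j)
}.

Section OpenBookHeegaard.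
Variable B : open_book_diagram.

(* [inr i] is x_xi^i in S_{1/2}; [inl x] is the crossing x in S_0. *)
Definition ob_pt : finType := (crossing B + 'I_(narcs B))%type.

(* alpha_i runs along a_i in S_{1/2} and then back along -a_i in S_0. *)
Definition ob_alpha (i : 'I_(narcs B)) : seq ob_pt :=
  inr i :: [seq inl x | x <- rev (aword i)].
Definition ob_beta (j : 'I_(narcs B)) : seq ob_pt :=
  inr j :: [seq inl x | x <- rev (cword j)].
Definition ob_on_alpha (p : ob_pt) : 'I_(narcs B) :=
  match p with inl x => on_a x | inr i => i end.
Definition ob_on_beta (p : ob_pt) : 'I_(narcs B) :=
  match p with inl x => on_c x | inr i => i end.

(* Sigma contains S_0 with the opposite orientation. *)
Definition ob_sign (p : ob_pt) : bool :=
  match p with inl x => ~~ csign x | inr _ => true end.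

(* At x_xi^i the thin strips between a_i and b_i are the two quadrants with
   oa = ob; the two others lie on the two sides of a_i in S_{1/2}, in the
   components containing the base points.  The boundary of such a component
   reaches the boundary of S only through the segments between such quadrants,
   and the components of S_0 minus the curves are disks; hence every boundary
   circle of a region containing a base point has such a corner, and all the
   other regions are disks. *)
Definition ob_pointed : {set quadrant ob_pt} :=
  [set q : quadrant ob_pt |
     (if q.1.1 is inr _ then true else false) && (q.1.2 != q.2)].

Let inl_inj : injective (@inl (crossing B) 'I_(narcs B)).
Proof. by move=> x y []. Qed.

Fact ob_wordE (w : 'I_(narcs B) -> seq (crossing B)) on
    (wE : forall i x, (x \in w i) = (on x == i)) i (p : ob_pt) :
  (p \in (inr i :: [seq inl x | x <- rev (w i)] : seq ob_pt)) =
  (match p with inl x => on x | inr j => j end == i).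
Proof.
rewrite inE; case: p => [x|j].
  by rewrite (mem_map inl_inj) mem_rev wE.
by rewrite [X in _ || X](_ : _ = false) ?orbF //; apply/negP=> /mapP[].
Qed.

Fact ob_word_uniq (w : seq (crossing B)) i : uniq w ->
  uniq (inr i :: [seq inl x | x <- rev w] : seq ob_pt).
Proof.
move=> uw; rewrite /= (map_inj_uniq inl_inj) rev_uniq uw andbT.
by apply/negP=> /mapP[].
Qed.

Definition heegaard_of : heegaard_diagram :=
  @HeegaardDiagram (narcs B) ob_pt ob_alpha ob_beta ob_on_alpha ob_on_beta
    ob_sign ob_pointed
    (ob_wordE (@awordE B)) (ob_wordE (@cwordE B))
    (fun i => ob_word_uniq i (aword_uniq i))
    (fun j => ob_word_uniq j (cword_uniq j)).

End OpenBookHeegaard.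

Section Domains.
Variable H : heegaard_diagram.
Local Notation N := (ncurves H).
Local Notation P := (pt H).
Local Notation quad := (quadrant (pt H)).

Definition next_alpha (p : P) : P := next (alpha (on_alpha p)) p.
Definition next_beta (p : P) : P := next (beta (on_beta p)) p.
Definition prev_beta (p : P) : P := prev (beta (on_beta p)) p.

Definition left_of_alpha (q : quad) : bool := q.2 == hsign q.1.1.
Definition left_of_beta (q : quad) : bool := q.1.2 != hsign q.1.1.

(* q lies at the tail of an edge, r at its head, both on the same side of it. *)
Definition along_alpha (q r : quad) : bool :=
  [&& q.1.2, ~~ r.1.2, r.1.1 == next_alpha q.1.1
    & left_of_alpha q == left_of_alpha r].
Definition along_beta (q r : quad) : bool :=
  [&& q.2, ~~ r.2, r.1.1 == next_beta q.1.1
    & left_of_beta q == left_of_beta r].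
Definition adjacent (q r : quad) : bool :=
  [|| along_alpha q r, along_alpha r q, along_beta q r | along_beta r q].

Definition corners (q : quad) : {set quad} := [set r | connect adjacent q r].

(* A region is given by the set of its corners; this determines the unpointed
   regions, which are disks. *)
Definition is_region (R : {set quad}) : bool :=
  (R \in [set corners q | q : quad]) && [disjoint R & pointed H].
Definition region : finType := {R : {set quad} | is_region R}.

(* A disk whose boundary has k corners is a k-gon. *)
Definition nice : Prop :=
  forall R : region, #|val R| = 2%N \/ #|val R| = 4%N.

Definition domain : choiceType := {ffun region -> int}.

Definition coef (D : domain) (q : quad) : int :=
  \sum_(R : region | q \in val R) D R.

(* The coefficient in the boundary of D, on which D lies to the left, of the
   beta-edge issued from p. *)
Definition bdry_beta (D : domain) (p : P) : int :=
  coef D (p, ~~ hsign p, true) - coef D (p, hsign p, true).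

Definition bdry_bdry_beta (D : domain) (p : P) : int :=
  bdry_beta D (prev_beta p) - bdry_beta D p.

(* A generator is a permutation s together with, for each i, a point of
   alpha_i and beta_(s i). *)
Definition is_generator (x : 'S_N * {ffun 'I_N -> P}) : bool :=
  [forall i, (on_alpha (x.2 i) == i) && (on_beta (x.2 i) == x.1 i)].
Definition generator : finType :=
  {x : 'S_N * {ffun 'I_N -> P} | is_generator x}.

Definition pairing (x : generator) : 'S_N := (val x).1.
Definition point (x : generator) (i : 'I_N) : P := (val x).2 i.
Definition chain0 (x : generator) (p : P) : int := (p \in codom (point x))%:R.

(* D belongs to pi2^(x, y). *)
Definition connects (x y : generator) (D : domain) : Prop :=
  forall p, bdry_bdry_beta D p = chain0 y p - chain0 x p.

(* Unpointed regions are disks, of Euler characteristic 1. *)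
Definition euler_measure (D : domain) : rat :=
  \sum_(R : region) (D R)%:~R * (1 - #|val R|%:R / 4%:R).

Definition point_measure (x : generator) (D : domain) : rat :=
  \sum_(i < N) (\sum_(s : bool * bool) (coef D (point x i, s.1, s.2))%:~R)
                 / 4%:R.

Definition maslov (x y : generator) (D : domain) : rat :=
  point_measure x D + point_measure y D + euler_measure D.

Definition ncycles (x : generator) : nat := #|porbits (pairing x)|.

Definition Jplus (x y : generator) (D : domain) : rat :=
  maslov x y D - 2%:R * euler_measure D + (ncycles x)%:R - (ncycles y)%:R.

Definition positive (D : domain) : Prop := forall R, 0 <= D R.

(** * The hat complex of a nice diagram *)

Definition CF : vectType 'F_2 := {ffun generator -> ('F_2)^o}.

Definition gen_chain (x : generator) : CF := [ffun y => (y == x)%:R].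

(* In a nice diagram each positive domain of Maslov index 1 is an empty embedded
   bigon or rectangle and has exactly one holomorphic representative, so
   counting curves amounts to counting such domains; they are finitely many. *)
Definition is_curve_domain (l : nat) (x y : generator) (D : domain) : Prop :=
  [/\ connects x y D, positive D, maslov x y D = 1
    & Jplus x y D = (2 * l)%:R].

Definition curve_count (l : nat) (x y : generator) : 'F_2 :=
  (#|` fset_set (is_curve_domain l x y : set domain)|)%:R.

Definition partial (l : nat) : 'End(CF) :=
  linfun (fun c : CF =>
    [ffun y => \sum_(x : generator) c x * curve_count l x y] : CF).

(** * Relative grading *)

(* y lies in the Spin^c structure of x, in Maslov grading k relative to x.
   The index of a domain from y to x is only defined up to the indices of the
   periodic domains, which are the multiples of the divisibility of the
   Spin^c structure. *)
Definition in_grading (x : generator) (k : int) (y : generator) : Prop :=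
  exists D Q : domain, [/\ connects y x D, connects x x Q
    & maslov y x D = k%:~R + maslov x x Q].

Definition graded_part (x : generator) (k : int) : {vspace CF} :=
  <<[seq gen_chain y | y <- enum generator & `[< in_grading x k y >]]>>%VS.

(** * The spectral sequence *)

(* Elements of CF (x) F[t, t^-1]: w j is the coefficient of t^j. *)
Definition laurent (w : int -> CF) : Prop :=
  finite_set [set j | w j != 0]%classic.

(* The differential \sum_l partial_l (x) t^-l. *)
Definition total_diff (w : int -> CF) (j : int) : CF :=
  \sum_(l \in [set: nat]%classic) partial l (w (j + l%:Z)).

Definition filt (p : int) (w : int -> CF) : Prop :=
  laurent w /\ forall j, p < j -> w j = 0.

Definition approx_cycle (r : nat) (p : int) (w : int -> CF) : Prop :=
  filt p w /\ filt (p - r%:Z) (total_diff w).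

(* E^r_p is the quotient of the image in F_p / F_(p-1) of the set Z^r_p of
   [approx_cycle]s by the image of d Z^(r-1)_(p+r-1). *)
Definition trivial_in_page (r : nat) (p : int) (w : int -> CF) : Prop :=
  approx_cycle r p w /\
  exists2 v, approx_cycle r.-1 (p + r%:Z - 1) v
           & filt (p - 1) (fun j => w j - total_diff v j).

Definition const_laurent (c : CF) (j : int) : CF := if j == 0 then c else 0.

End Domains.

(** * The canonical generator and the invariant o *)

Section Canonical.
Variable B : open_book_diagram.

Fact canonical_subproof :
  @is_generator (heegaard_of B) (1%g, [ffun i : 'I_(narcs B) => inr i]).
Proof. by apply/forallP=> i /=; rewrite ffunE perm1 !eqxx. Qed.

Definition x_xi : generator (heegaard_of B) := Sub _ canonical_subproof.

Definition chain_xi : CF (heegaard_of B) := gen_chain x_xi.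

Definition C_ (k : int) : {vspace CF (heegaard_of B)} := graded_part x_xi k.

Definition dies (k : nat) : Prop :=
  trivial_in_page k.+1 0 (const_laurent chain_xi).

(* None stands for infinity. *)
Definition order_o : option nat :=
  match pselect (exists k, `[< dies k >]) with
  | left ex => Some (ex_minn ex)
  | right _ => None
  end.

End Canonical.

(** * The maps delta^i *)

Section Delta.
Variables (F : fieldType) (V : vectType F) (d0 d1 : 'End(V)) (C1 : {vspace V}).

Definition restr (d : 'End(V)) : 'Hom(subvs_of C1, V) :=
  (d \o linfun (@vsval _ _ C1))%VF.

(* Meaningful on U0 when d1 is injective on C1; the inverse in
   MathComp extends it to V by an arbitrary choice of complement. *)
Definition delta : 'End(V) := (restr d0 \o (restr d1)^-1)%VF.

Definition U0 : {vspace V} := (d1 @: C1)%VS.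

Fixpoint U (i : nat) : {vspace V} :=
  if i is j.+1 then (U0 :&: delta @^-1: U j)%VS else U0.

(* For i >= 1; delta^i has domain U (i - 1). *)
Definition ker_delta (i : nat) : pred V :=
  [pred v | (v \in U i.-1) && (iter i delta v == 0)].

End Delta.

(* Main.v *)
From HB Require Import structures.
From mathcomp Require Import finmap boolp classical_sets cardinality fsbigop.
From mathcomp Require Import all_boot all_order all_fingroup all_algebra.
From mathcomp Require Import ring lra zify.
Require Import Defs.

(** Write xi for the canonical chain.  Some facts about curves turn the
    finiteness of o into a problem of linear algebra.

    Only d0 and d1 occur.  A positive domain of index 1 has nonnegative Euler
    measure, because the diagram is nice, and at each intersection point that
    differs between its two generators it has a positive local coefficient.  So
    at most two points move, the pairings differ by at most a transposition, and
    J_+ < 4 ([Jplus_lt4]).  Hence d_l = 0 for l >= 2 ([partial_eq0]).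

    The canonical generator is a cycle for every d_l ([partial_chain_xi]): at
    x_xi^i two opposite quadrants are pointed, so a positive domain leaving
    x_xi has coefficient 0 all around x_xi^i, and then its J_+ is -1.

    Consequently xi dies on some page if and only if there are chains w_0, w_1,
    ..., almost all zero, with
      d0 w_0 + d1 w_1 = xi   and   d0 w_j + d1 w_(j+1) = 0 for j >= 1
    ([diesP]): w_j is the coefficient of t^j in a Laurent chain whose
    differential has leading term xi.

    The w_j may be taken in C1.  This uses that d0 and d1 lower the relative
    grading by exactly 1, in both directions ([in_grading_curve]), so that
    projecting to grading 1 before differentiating amounts to projecting to
    grading 0 afterwards ([partial_grading_proj]).  Behind it lies the
    additivity of the Maslov index under composition of domains ([maslovD]),
    which is a summation by parts along the alpha- and the beta-curves.

    Finally, when d1 is injective on C1, a sequence w_1, w_2, ... in C1 as above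
    is determined by v = d1 w_1: up to sign, d1 w_(j+1) is delta^j v.  So
    the sequences that end in zeros correspond to the v in the kernel of some
    delta^i ([ker_delta_staircase]), that is in the largest of these kernels, and the
    remaining equation says that v - xi = - d0 w_0 lies in d0 C1.  A largest
    kernel exists because the kernels increase inside a space of finite
    dimension ([ker_delta_stationary]). *)

Set Implicit Arguments.
Unset Strict Implicit.
Unset Printing Implicit Defensive.

Import Order.TTheory GRing.Theory Num.Theory.
Local Open Scope ring_scope.

(** * Additivity of the Maslov index *)

Section MaslovIndex.
Variable H : heegaard_diagram.
Local Notation quad := (quadrant (pt H)).
Local Notation dom := {ffun region H -> int}.
Implicit Types (x y z : generator H) (D : dom) (p : pt H).

Lemma coefD D1 D2 (q : quad) : coef (D1 + D2) q = coef D1 q + coef D2 q.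
Proof.
by rewrite /coef -big_split /=; apply: eq_bigr => R _; rewrite ffunE.
Qed.

Lemma coefN D (q : quad) : coef (- D) q = - coef D q.
Proof. by rewrite /coef -sumrN; apply: eq_bigr => R _; rewrite ffunE. Qed.

Lemma coef0 (q : quad) : coef (0 : dom) q = 0.
Proof. by rewrite /coef big1 // => R _; rewrite ffunE. Qed.

Lemma coef_ge0 D (q : quad) : positive D -> 0 <= coef D q.
Proof. by move=> D0; apply: sumr_ge0 => R _; apply: D0. Qed.

Lemma coef_pointed D (q : quad) : q \in pointed H -> coef D q = 0.
Proof.
move=> qz; apply: big1 => R qR; have /andP[_ /disjointFr] := valP R.
by move=> /(_ _ qR); rewrite qz.
Qed.

Lemma adjacent_sym : symmetric (@adjacent H).
Proof.
by move=> q r; rewrite /adjacent orbCA; do 2!congr orb; rewrite orbC.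
Qed.

Lemma coef_adjacent D (q r : quad) : adjacent q r -> coef D q = coef D r.
Proof.
move=> qr; apply: eq_bigl => R; have /andP[/imsetP[q0 _ ->] _] := valP R.
rewrite !inE; have cs := sym_connect_sym adjacent_sym.
rewrite ![connect _ q0 _]cs; exact: same_connect (connect1 qr) _.
Qed.

Lemma on_alpha_next p : on_alpha (next_alpha p) = on_alpha p.
Proof. by apply/eqP; rewrite -alphaE mem_next alphaE. Qed.

Lemma on_beta_prev p : on_beta (prev_beta p) = on_beta p.
Proof. by apply/eqP; rewrite -betaE mem_prev betaE. Qed.

Lemma next_alpha_bij : bijective (@next_alpha H).
Proof.
apply: injF_bij => p q pq.
have on_pq : on_alpha p = on_alpha q by rewrite -on_alpha_next pq on_alpha_next.
move: pq; rewrite /next_alpha on_pq.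
exact/(can_inj (prev_next (alpha_uniq _))).
Qed.

Lemma prev_betaK : cancel (@prev_beta H) (@next_beta H).
Proof.
by move=> p; rewrite /next_beta on_beta_prev next_prev ?beta_uniq.
Qed.

Lemma prev_beta_bij : bijective (@prev_beta H).
Proof. exact: injF_bij (can_inj prev_betaK). Qed.

(** The two sides of the alpha-edge from p to its successor: for s = false the
    left side, for s = true the right side.  Expressing the side through [hsign]
    makes the same s serve at both ends of the edge, whatever the signs are. *)
Lemma coef_next_alpha D p (s : bool) :
  coef D (next_alpha p, false, s (+) hsign (next_alpha p)) =
  coef D (p, true, s (+) hsign p).
Proof.
symmetry; apply: coef_adjacent; apply/orP; left.
by rewrite /along_alpha /left_of_alpha /= eqxx; case: s; do 2 case: (hsign _).
Qed.

(** As for alpha-edges, except that s = false is now the right side: at a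
    crossing the roles of the two curves are exchanged with a sign. *)
Lemma coef_prev_beta D p (s : bool) :
  coef D (prev_beta p, s (+) hsign (prev_beta p), true) =
  coef D (p, s (+) hsign p, false).
Proof.
apply: coef_adjacent; apply/or4P; apply: Or43.
rewrite /along_beta /left_of_beta /= prev_betaK eqxx.
by case: s; do 2 case: (hsign _).
Qed.

(** Four times the average of the coefficients around p; working with the sum
    keeps the additivity argument inside the integers. *)
Definition local_sum D p : int :=
  coef D (p, true, true) + coef D (p, true, false)
  + coef D (p, false, true) + coef D (p, false, false).

(** The two beta-edges at p border the four quadrants at p, so the boundary of
    the beta-boundary of D is a signed alternating sum of local coefficients. *)
Lemma bdry_bdry_betaE D p :
  bdry_bdry_beta D p = (-1) ^+ (~~ hsign p) *
    (coef D (p, true, true) + coef D (p, false, false)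
     - coef D (p, true, false) - coef D (p, false, true)).
Proof.
rewrite /bdry_bdry_beta /bdry_beta.
rewrite (coef_prev_beta D p true) (coef_prev_beta D p false) /=.
by case: (hsign p) => /=; rewrite ?expr0 ?expr1; ring.
Qed.

(** Each alpha-edge is the outgoing edge at its tail and the incoming edge at
    its head.  A quantity computed from the coefficients on the two sides of
    the edge can therefore be summed over tails or over heads: this is the
    telescoping half of the summation by parts. *)
Lemma sum_alpha_edges (F : int -> int -> int -> int -> int) D1 D2 :
  \sum_p F (coef D1 (p, false, hsign p)) (coef D1 (p, false, ~~ hsign p))
           (coef D2 (p, false, hsign p)) (coef D2 (p, false, ~~ hsign p)) =
  \sum_p F (coef D1 (p, true, hsign p)) (coef D1 (p, true, ~~ hsign p))
           (coef D2 (p, true, hsign p)) (coef D2 (p, true, ~~ hsign p)).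
Proof.
have [g gK Kg] := next_alpha_bij.
rewrite (reindex (@next_alpha H)); last by exists g => ? _.
apply: eq_bigr => p _.
have L D := coef_next_alpha D p false; have R D := coef_next_alpha D p true.
by rewrite /= in L R; rewrite !L !R.
Qed.

Lemma sum_beta_edges (F : int -> int -> int -> int -> int) D1 D2 :
  \sum_p F (coef D1 (p, hsign p, false)) (coef D1 (p, ~~ hsign p, false))
           (coef D2 (p, hsign p, false)) (coef D2 (p, ~~ hsign p, false)) =
  \sum_p F (coef D1 (p, hsign p, true)) (coef D1 (p, ~~ hsign p, true))
           (coef D2 (p, hsign p, true)) (coef D2 (p, ~~ hsign p, true)).
Proof.
have [g gK Kg] := prev_beta_bij.
rewrite [RHS](reindex (@prev_beta H)); last by exists g => ? _.
apply: eq_bigr => p _.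
have L D := coef_prev_beta D p false; have R D := coef_prev_beta D p true.
by rewrite /= in L R; rewrite !L !R.
Qed.

(** The sum on the left moves the endpoints of the alpha-boundary of D2 along
    the alpha-curves, where the averaged coefficient of D1 only jumps when
    crossing the beta-boundary of D1; the sum on the right moves the endpoints
    of the beta-boundary of D1 along the beta-curves, where that of D2 only
    jumps when crossing the alpha-boundary of D2.  Summation by parts turns both into the
    averaged intersection number of these two boundaries. *)
Lemma bdry_intersection_symmetry D1 D2 :
  \sum_p bdry_bdry_beta D2 p * local_sum D1 p =
  \sum_p bdry_bdry_beta D1 p * local_sum D2 p.
Proof.
have := sum_alpha_edges (fun l1 r1 l2 r2 => (l2 - r2) * (l1 + r1)) D1 D2.
have := sum_beta_edges (fun r1 l1 r2 l2 => (l1 - r1) * (l2 + r2)) D1 D2.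
move=> /eqP; rewrite -subr_eq0 -sumrB; set sB := \sum_p _ => /eqP EB.
move=> /eqP; rewrite -subr_eq0 -sumrB; set sA := \sum_p _ => /eqP EA.
apply/eqP; rewrite -subr_eq0 -sumrB; apply/eqP.
(* After removing the telescoping sums over alpha- and beta-edges, the
   difference of the two sides vanishes separately at each point. *)
transitivity ((sA + sB) * -2); last by rewrite EA EB addr0 mul0r.
rewrite -big_split mulr_suml; apply: eq_bigr => p _ /=.
rewrite !bdry_bdry_betaE /local_sum.
by case: (hsign p) => /=; rewrite ?expr0 ?expr1; ring.
Qed.

Lemma on_alpha_point x i : on_alpha (point x i) = i.
Proof. by have /forallP/(_ i)/andP[/eqP] := valP x. Qed.

Lemma on_beta_point x i : on_beta (point x i) = pairing x i.
Proof. by have /forallP/(_ i)/andP[_ /eqP] := valP x. Qed.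

Lemma mem_point x p : (p \in codom (point x)) = (point x (on_alpha p) == p).
Proof.
apply/codomP/eqP => [[i ->]|<-]; first by rewrite on_alpha_point.
by eexists.
Qed.

Lemma point_measure_local_sum x D :
  point_measure x D = (\sum_i local_sum D (point x i))%:~R / 4%:R.
Proof.
rewrite /point_measure -mulr_suml rmorph_sum /=; congr (_ / _).
apply: eq_bigr => i _.
rewrite -(pair_bigA _ (fun a b => (coef D (point x i, a, b))%:~R)) /=.
by rewrite !big_bool /local_sum !rmorphD /= !addrA.
Qed.

Lemma point_measureE x D :
  point_measure x D = (\sum_p chain0 x p * local_sum D p)%:~R / 4%:R.
Proof.
rewrite point_measure_local_sum; congr (_%:~R / _).
transitivity (\sum_(p in codom (point x)) local_sum D p).
  rewrite (reindex_onto (point x) (@on_alpha H)) /=; last first.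
    by move=> p; rewrite mem_point => /eqP.
  by apply: eq_bigl => i; rewrite on_alpha_point codom_f eqxx.
rewrite big_mkcond; apply: eq_bigr => p _; rewrite /chain0.
by case: ifP; rewrite ?mul1r ?mul0r.
Qed.

Lemma point_measureD x D1 D2 :
  point_measure x (D1 + D2) = point_measure x D1 + point_measure x D2.
Proof.
rewrite !point_measureE -mulrDl -rmorphD /= -big_split /=; congr (_%:~R / _).
by apply: eq_bigr => p _; rewrite /local_sum !coefD; ring.
Qed.

Lemma point_measureN x D : point_measure x (- D) = - point_measure x D.
Proof.
rewrite !point_measureE -mulNr -rmorphN /= -sumrN; congr (_%:~R / _).
by apply: eq_bigr => p _; rewrite /local_sum !coefN; ring.
Qed.

Lemma euler_measureD D1 D2 :
  euler_measure (D1 + D2) = euler_measure D1 + euler_measure D2.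
Proof.
rewrite /euler_measure -big_split; apply: eq_bigr => R _.
by rewrite ffunE rmorphD /= mulrDl.
Qed.

Lemma euler_measureN D : euler_measure (- D) = - euler_measure D.
Proof.
rewrite /euler_measure -sumrN; apply: eq_bigr => R _.
by rewrite ffunE rmorphN /= mulNr.
Qed.

Lemma connects0 x : connects x x (0 : dom).
Proof. by move=> p; rewrite bdry_bdry_betaE !coef0 subrr; ring. Qed.

Lemma connectsD x y z D1 D2 :
  connects x y D1 -> connects y z D2 -> connects x z (D1 + D2).
Proof.
move=> xy yz p; have := yz p; have := xy p; rewrite !bdry_bdry_betaE !coefD.
move=> exy eyz; rewrite (_ : chain0 z p - chain0 x p =
  (chain0 y p - chain0 x p) + (chain0 z p - chain0 y p)); last by ring.
by rewrite -exy -eyz; ring.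
Qed.

Lemma connectsN x y D : connects x y D -> connects y x (- D).
Proof.
move=> xy p; have := xy p; rewrite !bdry_bdry_betaE !coefN => e.
by rewrite -(opprB (chain0 y p)) -e; ring.
Qed.

Lemma maslovN x y D : maslov y x (- D) = - maslov x y D.
Proof.
by rewrite /maslov !point_measureN euler_measureN -!opprD [_ x D + _]addrC.
Qed.

(** Expanding the definition, additivity is the equality
    n_z(D1) - n_y(D1) = n_y(D2) - n_x(D2); since y - x and z - y are the
    boundaries of the beta-boundaries of D1 and D2, it is the symmetry
    [bdry_intersection_symmetry]. *)
Lemma maslovD x y z D1 D2 : connects x y D1 -> connects y z D2 ->
  maslov x z (D1 + D2) = maslov x y D1 + maslov y z D2.
Proof.
move=> xy yz; rewrite /maslov !point_measureD euler_measureD.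
suff E : point_measure z D1 - point_measure y D1 =
         point_measure y D2 - point_measure x D2 by lra.
rewrite !point_measureE -!mulrBl -!rmorphB /= -!sumrB; congr (_%:~R / _).
transitivity (\sum_p bdry_bdry_beta D2 p * local_sum D1 p).
  by apply: eq_bigr => p _; rewrite yz mulrBl.
rewrite bdry_intersection_symmetry.
by apply: eq_bigr => p _; rewrite xy mulrBl.
Qed.

Lemma in_grading_canonical x : in_grading x 0 x.
Proof.
exists (0 : dom), (0 : dom); split; [exact: connects0 | exact: connects0 |].
by rewrite add0r.
Qed.

(** Composing with D, or with - D, exchanges the domains that relate x and y to
    xi and shifts the index by 1; the periodic domain is left unchanged.  Both
    directions matter: generators outside grading 1 must not map into grading
    0. *)
Lemma in_grading_curve (xi x y : generator H) l D : is_curve_domain l x y D ->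
  in_grading xi 1 x <-> in_grading xi 0 y.
Proof.
case=> xy _ mu1 _; split=> -[E [Q [cE cQ muE]]].
  exists (- D + E : dom), Q; split=> //.
    exact: connectsD (connectsN xy) cE.
  rewrite (maslovD (connectsN xy) cE) maslovN mu1 muE; lra.
exists (D + E : dom), Q; split=> //; first exact: connectsD xy cE.
by rewrite (maslovD xy cE) mu1 muE; lra.
Qed.
End MaslovIndex.

(** * Curves have J_+ at most 2 *)

Section Differentials.
Variable H : heegaard_diagram.
Local Notation quad := (quadrant (pt H)).
Local Notation dom := {ffun region H -> int}.
Implicit Types (x y z : generator H) (D : dom) (p : pt H) (c : CF H).

(** Bigons contribute 1/2 and rectangles 0. *)
Lemma euler_measure_ge0 D : nice H -> positive D -> 0 <= euler_measure D.
Proof.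
move=> niceH posD; apply: sumr_ge0 => R _; apply: mulr_ge0.
  by rewrite ler0z posD.
by case: (niceH R) => ->; lra.
Qed.

Lemma local_sum_ge0 D p : positive D -> 0 <= local_sum D p.
Proof. by move=> posD; rewrite !addr_ge0 ?coef_ge0. Qed.

Lemma local_sum_gt0 D p :
  positive D -> bdry_bdry_beta D p != 0 -> 1 <= local_sum D p.
Proof.
move=> posD; rewrite -[1]/(0 + 1 : int) lezD1 lt_neqAle local_sum_ge0 // andbT.
rewrite eq_sym; apply: contraNneq; rewrite bdry_bdry_betaE /local_sum.
have c0 (q : quad) : 0 <= coef D q by apply: coef_ge0.
have := c0 (p, true, true); have := c0 (p, true, false).
have := c0 (p, false, true); have := c0 (p, false, false).
move=> h1 h2 h3 h4 h0.
have -> : coef D (p, true, true) = 0 by lia.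
have -> : coef D (p, true, false) = 0 by lia.
have -> : coef D (p, false, true) = 0 by lia.
have -> : coef D (p, false, false) = 0 by lia.
by rewrite !addr0 mulr0.
Qed.

Definition moved x y : {set 'I_(ncurves H)} := [set i | point x i != point y i].

Lemma movedC x y : moved x y = moved y x.
Proof. by apply/setP => i; rewrite !inE eq_sym. Qed.

Lemma chain0_point x y i : chain0 y (point x i) = (i \notin moved x y)%:R.
Proof. by rewrite /chain0 mem_point on_alpha_point inE negbK eq_sym. Qed.

Lemma chain0_self x i : chain0 x (point x i) = 1.
Proof. by rewrite chain0_point inE eqxx. Qed.

Lemma card_moved_le x y w D : positive D ->
  (forall i, i \in moved x y -> bdry_bdry_beta D (point w i) != 0) ->
  #|moved x y|%:R / 4%:R <= point_measure w D.
Proof.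
move=> posD bD; rewrite point_measure_local_sum.
rewrite ler_pM2r ?invr_gt0 ?ltr0n // pmulrn ler_int -natz.
rewrite -sum1_card natr_sum.
rewrite [leLHS]big_mkcond /=; apply: ler_sum => i _; case: ifP => [/bD|_].
  exact: local_sum_gt0.
exact: local_sum_ge0.
Qed.

(** A moved point lies in the boundary of the beta-boundary of D, so some
    coefficient around it is at least 1; it contributes at least 1/4 to the
    point measure, once for x and once for y. *)
Lemma card_moved_maslov x y D : connects x y D -> positive D ->
  #|moved x y|%:R / 2%:R + euler_measure D <= maslov x y D.
Proof.
move=> xy posD; rewrite /maslov.
have hx : #|moved x y|%:R / 4%:R <= point_measure x D.
  apply: card_moved_le => // i im; rewrite xy chain0_self chain0_point im.
  by [].
have hy : #|moved x y|%:R / 4%:R <= point_measure y D.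
  apply: card_moved_le => // i im; rewrite xy chain0_self chain0_point.
  by rewrite movedC im.
lra.
Qed.

Lemma perm_supp2 (T : finType) (s : {perm T}) (M : {set T}) :
  (#|M| <= 2)%N -> {in ~: M, s =1 id} ->
  s = 1%g \/ exists a b, s = tperm a b.
Proof.
move=> M2 sM.
have memM i : s i != i -> i \in M.
  by apply: contraNT => iM; rewrite sM // inE.
case: (pickP (fun a => s a != a)) => [a sa|s1]; [right | left]; last first.
  by apply/permP => i; rewrite perm1; apply/eqP/negbFE/s1.
have ssa : s (s a) != s a by rewrite (inj_eq perm_inj).
have subM : [set a; s a] \subset M.
  by apply/subsetP => i; rewrite !inE => /orP[]/eqP->; apply: memM.
have EM : [set a; s a] = M.
  by apply/eqP; rewrite eqEcard subM cards2 eq_sym sa.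
have sE i : s i != i -> i = a \/ i = s a.
  by move/memM; rewrite -EM !inE => /orP[]/eqP; [left | right].
exists a, (s a); apply/permP => i; case: tpermP => [->//|->|ia isa].
  have /sE[] // : s (s (s a)) != s (s a) by rewrite (inj_eq perm_inj).
  by move=> e; rewrite e eqxx in ssa.
by case: (eqVneq (s i) i) => // /sE[].
Qed.

(** With at most two moved points the pairings differ by at most a
    transposition, which splits or merges at most one cycle. *)
Lemma ncycles_moved2 x y :
  (#|moved x y| <= 2)%N -> (ncycles x <= ncycles y + 1)%N.
Proof.
move=> M2; set t := (pairing y * (pairing x)^-1)%g.
have yE : pairing y = (t * pairing x)%g by rewrite /t mulgKV.
case: (perm_supp2 (s := t) M2) => [i|t1|[a [b tE]]].
- rewrite !inE negbK => /eqP xyi.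
  by rewrite permM -(on_beta_point y) -xyi on_beta_point permK.
- by rewrite /ncycles yE t1 mul1g leq_addr.
rewrite /ncycles yE tE; have /= := porbits_mul_tperm (pairing x) a b.
case: (eqVneq a b) => [->|_]; last by lia.
by rewrite porbit_id /=; lia.
Qed.

(** Here J_+ is 1 - 2 e + |x| - |y|, where e >= 0 and |x| - |y| <= 1. *)
Lemma Jplus_lt4 x y D : nice H -> connects x y D -> positive D ->
  maslov x y D = 1 -> Jplus x y D < 4%:R.
Proof.
move=> niceH xy posD mu1; have := card_moved_maslov xy posD.
have := euler_measure_ge0 niceH posD; rewrite /Jplus mu1 => e0 le1.
have M2 : (#|moved x y| <= 2)%N by rewrite -(ler_nat rat); lra.
have := ncycles_moved2 M2; rewrite -(ler_nat rat) natrD; lra.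
Qed.

Lemma curve_count_eq0 l x y :
  (forall D, ~ is_curve_domain l x y D) -> curve_count l x y = 0.
Proof.
move=> no; rewrite /curve_count.
rewrite (_ : (is_curve_domain l x y : classical_sets.set _) =
             classical_sets.set0).
  by rewrite fset_set0 cardfs0.
by apply/classical_sets.seteqP; split=> // D /no.
Qed.

Lemma curve_count_neq0 l x y :
  curve_count l x y != 0 -> exists D, is_curve_domain l x y D.
Proof.
move=> n0; apply: contrapT => no; move/eqP: n0; apply.
by apply: curve_count_eq0 => D cD; apply: no; exists D.
Qed.

(** The function underlying [partial H l], named so that it can carry the
    structure of a linear map. *)
Definition curve_sum l c : CF H :=
  [ffun y => \sum_(x : generator H) c x * curve_count l x y].

Fact curve_sum_is_linear l : linear (curve_sum l).
Proof.
move=> a u v; apply/ffunP => y; rewrite !ffunE scaler_sumr -big_split.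
by apply: eq_bigr => x _; rewrite !ffunE mulrDl -scalerAl.
Qed.

HB.instance Definition _ l :=
  GRing.isLinear.Build 'F_2 (CF H) (CF H) *:%R (curve_sum l)
    (curve_sum_is_linear l).

Lemma partialE l c y : partial H l c y = \sum_x c x * curve_count l x y.
Proof. by rewrite (lfunE (curve_sum l)) ffunE. Qed.

(** A curve counted by [partial H l] has J_+ = 2 l, which is at least 4. *)
Lemma partial_eq0 l : nice H -> (1 < l)%N -> partial H l = 0.
Proof.
move=> niceH l2; apply/lfunP => c; apply/ffunP => y.
rewrite partialE lfunE ffunE; apply: big1 => x _.
rewrite curve_count_eq0 ?mulr0 // => D [xy posD mu1 J].
have := Jplus_lt4 niceH xy posD mu1; rewrite J ltr_nat; lia.
Qed.

Lemma partial_gen_chain l x y : partial H l (gen_chain x) y = curve_count l x y.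
Proof.
rewrite partialE (bigD1 x) //= ffunE eqxx mul1r big1 ?addr0 // => z zx.
by rewrite ffunE (negPf zx) mul0r.
Qed.

End Differentials.

(** * Projection to a Maslov grading *)

(** The space of functions carries its structure of vector space in the type, so
    that these elements can span a subspace. *)
Definition delta_ffun (F : fieldType) (I : finType) (y : I) :
  ({ffun I -> F^o} : vectType F) := [ffun z => (z == y)%:R].

Lemma restriction_in_span (F : fieldType) (I : finType) (P : pred I)
    (c : ({ffun I -> F^o} : vectType F)) :
  ([ffun y => if P y then c y else 0] : ({ffun I -> F^o} : vectType F)) \in
    <<[seq delta_ffun F y | y <- enum I & P y]>>%VS.
Proof.
have -> : ([ffun y => if P y then c y else 0] :
             ({ffun I -> F^o} : vectType F)) =
    \sum_(y | P y) c y *: delta_ffun F y.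
  apply/ffunP => z; rewrite sum_ffunE ffunE big_mkcond (bigD1 z) //=.
  rewrite [X in _ = _ + X]big1 ?addr0.
    by case: (P z); rewrite // !ffunE eqxx /= [RHS]mulr1.
  move=> y yz; case: (P y) => //; rewrite !ffunE eq_sym (negPf yz).
  exact: mulr0.
apply: memv_suml => y yk; apply/memvZ/memv_span/mapP; exists y => //.
by rewrite mem_filter yk mem_enum.
Qed.

Section Grading.
Variables (H : heegaard_diagram) (xi : generator H).
Implicit Types (x y : generator H) (c : CF H).

Definition grading_proj (k : int) c : CF H :=
  [ffun y => if `[< in_grading xi k y >] then c y else 0].

Lemma grading_proj_in k c : grading_proj k c \in graded_part xi k.
Proof.
exact: (@restriction_in_span 'F_2 (generator H)
         (fun y => `[< in_grading xi k y >]) c).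
Qed.

Lemma grading_projD k c c' :
  grading_proj k (c + c') = grading_proj k c + grading_proj k c'.
Proof.
by apply/ffunP => y; rewrite !ffunE; case: ifP; rewrite ?addr0.
Qed.

Lemma grading_proj0 k : grading_proj k 0 = 0.
Proof. by apply/ffunP => y; rewrite !ffunE if_same. Qed.

Lemma grading_proj_gen_chain : grading_proj 0 (gen_chain xi) = gen_chain xi.
Proof.
apply/ffunP => y; rewrite !ffunE; case: eqP => [->|_]; last by rewrite if_same.
by rewrite asboolT //; apply: in_grading_canonical.
Qed.

(** Each curve either goes from grading 1 to grading 0, or neither starts in
    grading 1 nor ends in grading 0. *)
Lemma partial_grading_proj l c :
  partial H l (grading_proj 1 c) = grading_proj 0 (partial H l c).
Proof.
apply/ffunP => y; rewrite ffunE !partialE -[RHS]mulrb -sumrMnl.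
apply: eq_bigr => x _; rewrite ffunE.
have [->|/curve_count_neq0[D /(in_grading_curve xi) xy]] :=
  eqVneq (curve_count l x y) 0; first by rewrite !mulr0 mul0rn.
rewrite (asbool_equiv_eq xy); case: ifP => _; rewrite ?mulr1n ?mulr0n //.
by rewrite mul0r.
Qed.

End Grading.

(** * The canonical generator is a cycle *)

Section CanonicalCycle.
Variable B : open_book_diagram.

Lemma point_x_xi i : point (x_xi B) i = inr i.
Proof. by rewrite /point /= ffunE. Qed.

(** Write c_++ and c_-- for the coefficients in the two thin strips at x_xi^i.
    The two other quadrants there are pointed, so the boundary condition reads
    c_++ + c_-- = y(x_xi^i) - 1 <= 0.  Hence D vanishes near x_xi, y = x_xi, the
    Euler measure of D equals its index 1, and J_+ = 1 - 2 = -1 is not of the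
    form 2 l. *)
Lemma no_curve_from_canonical l y D : ~ is_curve_domain l (x_xi B) y D.
Proof.
case=> xy posD mu1 J.
have z0 (i : 'I_(narcs B)) a : coef D (inr i : pt (heegaard_of B), a, ~~ a) = 0.
  by apply: coef_pointed; rewrite inE /=; case: a.
have c0 q : 0 <= coef D q by apply: coef_ge0.
have both i : local_sum D (point (x_xi B) i) = 0 /\ i \notin moved (x_xi B) y.
  have := xy (point (x_xi B) i).
  rewrite bdry_bdry_betaE chain0_self chain0_point.
  rewrite /local_sum point_x_xi /= (z0 i true) (z0 i false) mul1r.
  have := c0 (inr i, true, true); have := c0 (inr i, false, false).
  by case: (i \notin _) => /=; split=> //; lia.
have M0 : moved (x_xi B) y = set0.
  by apply/setP => i; rewrite in_set0; apply/negbTE; case: (both i).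
have same i : point y i = point (x_xi B) i.
  by have := in_set0 i; rewrite -M0 inE => /negbFE/eqP.
have n0 w : (forall i, point w i = point (x_xi B) i) -> point_measure w D = 0.
  move=> wx; rewrite point_measure_local_sum big1 ?mul0r // => i _.
  by rewrite wx (both i).1.
move: mu1 J; rewrite /Jplus => mu1; rewrite mu1.
move: mu1; rewrite /maslov !n0 // => e1.
have -> : ncycles y = ncycles (x_xi B).
  congr #|porbits _|; apply/permP => i.
  by rewrite -!on_beta_point same.
have : (0 : rat) <= (2 * l)%:R by [].
lra.
Qed.

Lemma partial_chain_xi l : partial (heegaard_of B) l (chain_xi B) = 0.
Proof.
apply/ffunP => y; rewrite partial_gen_chain ffunE.
exact/curve_count_eq0/no_curve_from_canonical.
Qed.
End CanonicalCycle.

(** * Kernels of the iterates of delta *)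

Lemma bounded_homo_stationary (f : nat -> nat) (b : nat) :
  {homo f : m n / (m <= n)%N} -> (forall n, f n <= b)%N ->
  exists m, forall n, (m <= n)%N -> f n = f m.
Proof.
move=> f_homo f_le.
have ex : exists d, `[< exists m, f m = d >].
  by exists (f 0); apply/asboolP; exists 0.
have le d : `[< exists m, f m = d >] -> (d <= b)%N by move/asboolP => [m <-].
case: (ex_maxnP ex le) => d /asboolP[m <-] max; exists m => n mn.
apply/eqP; rewrite eqn_leq (f_homo _ _ mn) andbT max //.
by apply/asboolP; exists n.
Qed.

Section Delta.
Variables (F : fieldType) (V : vectType F) (d0 d1 : 'End(V)) (C1 : {vspace V}).
Local Notation delta := (delta d0 d1 C1).
Local Notation U := (U d0 d1 C1).
Local Notation U0 := (U0 d1 C1).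
Local Notation ker_delta := (ker_delta d0 d1 C1).

(** On U0 this chooses a preimage under d1 in C1; it is linear on all of V, so
    that [delta] is d0 composed with it without any condition. *)
Definition d1_preim (u : V) : V := vsval ((restr C1 d1)^-1%VF u).

Lemma d1_preim_in u : d1_preim u \in C1. Proof. exact: subvsP. Qed.

Lemma d1_preim0 : d1_preim 0 = 0. Proof. by rewrite /d1_preim !linear0. Qed.

Lemma restrE (d : 'End(V)) (c : subvs_of C1) : restr C1 d c = d (vsval c).
Proof. by rewrite /restr comp_lfunE (lfunE (@vsval _ _ C1)). Qed.

Lemma delta_d1_preim u : delta u = d0 (d1_preim u).
Proof. by rewrite /Defs.delta comp_lfunE restrE. Qed.

Lemma d1_preimK u : u \in U0 -> d1 (d1_preim u) = u.
Proof.
move=> /memv_imgP[c cC ->]; rewrite -restrE limg_lfunVK //.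
apply/memv_imgP; exists (vsproj C1 c); first exact: memvf.
by rewrite restrE vsprojK.
Qed.

Lemma mem_U i v :
  (v \in U i) <-> (forall j, (j <= i)%N -> iter j delta v \in U0).
Proof.
elim: i v => [|i IHi] v /=.
  by split=> [vU j|/(_ 0%N)]; [rewrite leqn0 => /eqP-> | apply].
rewrite memv_cap -memv_preim; split=> [/andP[v0 /IHi vU] [|j] ji //|vU].
  by rewrite iterSr vU.
apply/andP; split; first exact: (vU 0%N).
by apply/IHi => j ji; rewrite -iterSr vU.
Qed.

Lemma ker_deltaP i v : (0 < i)%N -> (v \in ker_delta i) <->
  (forall j, (j < i)%N -> iter j delta v \in U0) /\ iter i delta v = 0.
Proof.
case: i => // i _; rewrite inE; split=> [/andP[/mem_U vU /eqP]|[vU /eqP v0]] //.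
by apply/andP; split=> //; apply/mem_U.
Qed.

Lemma iter_delta_eq0 i v : iter i delta v = 0 ->
  forall j, (i <= j)%N -> iter j delta v = 0.
Proof.
move=> vi j /subnK <-; rewrite iterD vi; elim: (j - i)%N => //= n ->.
exact: linear0.
Qed.

(** The membership in the domain of delta^j is automatic: the iterates vanish
    from delta^i v on, and 0 lies in U0. *)
Lemma ker_delta_homo i j : (0 < i)%N -> (i <= j)%N ->
  {subset ker_delta i <= ker_delta j}.
Proof.
move=> i0 ij v /(ker_deltaP _ i0)[vU vi].
have v0 := iter_delta_eq0 vi.
apply/ker_deltaP; first exact: leq_trans ij.
split=> [k kj|]; last exact: v0.
by case: (ltnP k i) => [/vU //|/v0 ->]; apply: mem0v.
Qed.

(** The kernels form an increasing chain of subspaces, so their dimensions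
    stabilize. *)
Lemma ker_delta_stationary : exists m, (0 < m)%N /\
  forall i, (0 < i)%N -> {subset ker_delta i <= ker_delta m}.
Proof.
(* K i is the kernel of delta^(i+1) as a subspace; the shift absorbs U i.-1. *)
pose K i := (U i :&: lker (iter i.+1 (comp_lfun delta) \1%VF))%VS.
have powE i v : iter i (comp_lfun delta) \1%VF v = iter i delta v.
  by elim: i => [|i /= <-]; rewrite ?id_lfunE // comp_lfunE.
have memK i v : (v \in K i) = (v \in ker_delta i.+1).
  by rewrite inE memv_cap memv_ker powE.
have K_homo i j : (i <= j)%N -> (K i <= K j)%VS.
  by move=> ij; apply/subvP => v; rewrite !memK; apply: ker_delta_homo.
have dim_homo : {homo (fun i => \dim (K i)) : i j / (i <= j)%N}.
  by move=> i j ij; apply/dimvS/K_homo.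
have dim_le i : (\dim (K i) <= \dim {:V})%N by apply/dimvS/subvf.
have [m mP] := bounded_homo_stationary dim_homo dim_le.
exists m.+1; split=> // -[//|i] _ v; rewrite -!memK.
have /eqP -> : K m == K (maxn i m).
  by rewrite eqEdim (K_homo _ _ (leq_maxr i m)) (mP _ (leq_maxr i m)) /=.
by apply/subvP/K_homo/leq_maxl.
Qed.

Hypothesis d1_inj : {in C1 &, injective d1}.

Lemma deltaE c : c \in C1 -> delta (d1 c) = d0 c.
Proof.
move=> cC; rewrite delta_d1_preim; congr (d0 _); apply: d1_inj => //.
  exact: d1_preim_in.
by rewrite d1_preimK // memv_img.
Qed.

(** The elements v, delta v, delta^2 v, ... all lie in U0 exactly when v can be
    lifted step by step: w_j is, up to the sign (-1)^j, the preimage in C1 of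
    delta^j v under d1, and delta^(j+1) v is, up to that sign, d0 w_j.  The
    sequence of lifts ends in zeros exactly when some delta^i v is 0. *)
Lemma ker_delta_staircase v :
  (exists2 i, (0 < i)%N & v \in ker_delta i) <->
  (exists2 w : nat -> V, [/\ forall j, w j \in C1, d1 (w 0%N) = v
                           & forall j, d0 (w j) + d1 (w j.+1) = 0]
                       & exists n, forall j, (n <= j)%N -> w j = 0).
Proof.
split=> [[i i0 /(ker_deltaP _ i0)[vU vi]]|[w [wC w0 wS] [n wn]]].
  have v0 := iter_delta_eq0 vi.
  have {}vU j : iter j delta v \in U0.
    by case: (ltnP j i) => [/vU|/v0 ->] //; apply: mem0v.
  exists (fun j => (-1) ^+ j *: d1_preim (iter j delta v)); last first.
    by exists i => j /v0 ->; rewrite d1_preim0 scaler0.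
  split=> [j||j]; first exact/memvZ/d1_preim_in.
    by rewrite expr0 scale1r d1_preimK // (vU 0%N).
  rewrite !linearZ /= d1_preimK ?(vU j.+1) // -delta_d1_preim.
  by rewrite exprS mulN1r scaleNr subrr.
have wE j : iter j delta v = (-1) ^+ j *: d1 (w j).
  elim: j => [|j IHj]; first by rewrite expr0 scale1r.
  rewrite /= IHj linearZ /= deltaE // exprS mulN1r scaleNr -scalerN.
  by congr (_ *: _); apply/eqP; rewrite -addr_eq0 wS.
exists n.+1 => //; apply/ker_deltaP => //; split=> [j _|]; last first.
  by rewrite wE wn // linear0 scaler0.
by rewrite wE memvZ // memv_img.
Qed.

End Delta.

(** * Pages of the spectral sequence *)

Section SpectralSequence.
Variable H : heegaard_diagram.
Hypothesis niceH : nice H.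
Local Notation d0 := (partial H 0).
Local Notation d1 := (partial H 1).

Lemma total_diffE (w : int -> CF H) j :
  total_diff w j = d0 (w j) + d1 (w (j + 1)).
Proof.
rewrite /total_diff (fsbigTE [fset 0%N; 1%N]%fset) => [|l]; last first.
  rewrite in_fset2 negb_or => /andP[l0 l1].
  by rewrite partial_eq0 ?lfunE //; case: l l0 l1 => [|[]].
by rewrite big_fsetU1 ?in_fset1 //= big_seq_fset1 addr0.
Qed.

Lemma laurent_bounded (w : int -> CF H) (n : nat) :
  (forall j, w j != 0 -> - n%:Z <= j <= n%:Z) -> laurent w.
Proof.
move=> wn; rewrite /laurent.
apply: (@sub_finite_set _ _
  (classical_sets.image (`I_(n + n).+1) (fun i : nat => i%:Z - n%:Z))).
  move=> j /= /wn jn; exists (absz (j + n%:Z)) => /=; lia.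
exact/finite_image/finite_II.
Qed.
End SpectralSequence.

Section Order.
Variable B : open_book_diagram.
Local Notation H := (heegaard_of B).
Hypothesis niceH : nice H.
Local Notation d0 := (partial H 0).
Local Notation d1 := (partial H 1).

(** Killing xi on page k+1 means finding a Laurent chain v with exponents at
    most k whose differential is xi in degree 0 and 0 in higher degrees; that xi
    itself survives to this page is automatic as it is a cycle.  The
    coefficients of negative powers of t only affect the differential below
    degree 0, where it is unconstrained, so they can be discarded. *)
Lemma diesP k : dies B k <->
  exists w : nat -> CF H,
    [/\ d0 (w 0%N) + d1 (w 1%N) = chain_xi B,
        forall j, d0 (w j.+1) + d1 (w j.+2) = 0
      & forall j, (k < j)%N -> w j = 0].
Proof.
have const0 j : j != 0 -> const_laurent (chain_xi B) j = 0.
  by rewrite /const_laurent => /negPf->.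
have d_const j : total_diff (const_laurent (chain_xi B)) j = 0.
  rewrite total_diffE // /const_laurent.
  by do 2 case: ifP => _; rewrite ?partial_chain_xi ?linear0 ?addr0.
split=> [[_ [v [[_ v_top] _] [_ vxi]]]|[w [w0 wS wk]]].
  have dv (j : nat) :
      d0 (v j%:Z) + d1 (v j.+1%:Z) = const_laurent (chain_xi B) j%:Z.
    rewrite (_ : j.+1%:Z = j%:Z + 1); last by lia.
    rewrite -total_diffE //; apply/esym/eqP; rewrite -subr_eq0 vxi //; lia.
  exists (fun j : nat => v j%:Z); split=> [|j|j kj].
  - by rewrite dv.
  - by rewrite dv const0.
  by apply: v_top; lia.
pose v (j : int) := if j is Posz n then w n else 0.
have v_supp j : v j != 0 -> 0 <= j <= k%:Z.
  case: j => [j|j] /=; last by rewrite eqxx.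
  by case: (ltnP k j) => [/wk ->|]; [rewrite eqxx | lia].
have dv_supp j : total_diff v j != 0 -> - k.+1%:Z <= j <= k.+1%:Z.
  rewrite total_diffE //; have [->|/v_supp] := eqVneq (v j) 0; last by lia.
  have [->|/v_supp] := eqVneq (v (j + 1)) 0; last by lia.
  by rewrite !linear0 addr0 eqxx.
have dv (j : nat) : total_diff v j%:Z = const_laurent (chain_xi B) j%:Z.
  rewrite total_diffE // (_ : j%:Z + 1 = j.+1%:Z) /=; last by lia.
  by case: j => [|j]; [rewrite w0 | rewrite wS].
split.
  split; split.
  - apply: (laurent_bounded (n := 0)) => j; apply: contraNT => j0.
    by rewrite const0 //; lia.
  - by move=> j j0; rewrite const0 //; lia.
  - by apply: (laurent_bounded (n := 0)) => j; rewrite d_const eqxx.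
  - by move=> j _.
exists v; first (split; split).
- by apply: (laurent_bounded (n := k)) => j /v_supp; lia.
- by case=> [j|j] /= jk; [apply: wk; lia|].
- exact: laurent_bounded dv_supp.
- by case=> [j|j] /= jk; [rewrite dv const0 //; lia | lia].
split.
  apply: (laurent_bounded (n := k.+1)) => j.
  have [->|/dv_supp //] := eqVneq (total_diff v j) 0.
  have [->|] := eqVneq j 0; first lia.
  by move=> /const0 ->; rewrite subr0 eqxx.
by case=> [j|j] /= jlt; [rewrite dv subrr | lia].
Qed.

Lemma order_o_finite : order_o B <> None <-> exists k, dies B k.
Proof.
rewrite /order_o; case: pselect => [ex|nex]; split=> //.
  by move=> _; have [k /asboolP] := ex; exists k.
by case=> k dk; case: nex; exists k; apply/asboolP.
Qed.
End Order.

(** * Finiteness of o *)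

Theorem theorem5 (B : open_book_diagram) :
  let H := heegaard_of B in
  let d0 := partial H 0 in
  let d1 := partial H 1 in
  let C1 := C_ B 1 in
  nice H ->
  {in C1 &, injective d1} ->
  ~ {in C1 &, injective d0} ->
  let is_max m :=
    (0 < m)%N /\ forall i, (0 < i)%N ->
      {subset ker_delta d0 d1 C1 i <= ker_delta d0 d1 C1 m} in
  (exists m, is_max m) /\
  forall m, is_max m ->
    (order_o B <> None <->
     exists2 v, v \in ker_delta d0 d1 C1 m
              & (v - chain_xi B \in (d0 @: C1)%VS)%R).
Proof.
move=> H d0 d1 C1 niceH d1_inj _ is_max; split.
  exact: ker_delta_stationary.
move=> m [m0 max_m]; split.
  move=> /order_o_finite[k /(diesP niceH)[w [w0 wS wk]]].
  (* The chains that kill xi need not be homogeneous. *)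
  pose w' j := grading_proj (x_xi B) 1 (w j).
  have w'C j : w' j \in C1 by apply: grading_proj_in.
  have dw' i j : d0 (w' i) + d1 (w' j) =
      grading_proj (x_xi B) 0 (d0 (w i) + d1 (w j)).
    by rewrite grading_projD /d0 /d1 !partial_grading_proj.
  exists (d1 (w' 1%N)).
    suff [i i0 /(max_m _ i0)] : exists2 i, (0 < i)%N
      & d1 (w' 1%N) \in ker_delta d0 d1 C1 i by [].
    apply/ker_delta_staircase => //; exists (fun j => w' j.+1).
      by split=> // j; rewrite dw' wS grading_proj0.
    by exists k => j kj; rewrite /w' wk // grading_proj0.
  have : d0 (w' 0%N) + d1 (w' 1%N) = chain_xi B.
    by rewrite dw' w0 grading_proj_gen_chain.
  move=> <-; rewrite opprD addrCA subrr addr0 -linearN memv_img //.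
  by rewrite memvN.
case=> v vm /memv_imgP[c cC vE].
have /(ker_delta_staircase _ d1_inj)[w [wC w0 wS] [n wn]] :
  exists2 i, (0 < i)%N & v \in ker_delta d0 d1 C1 i by exists m.
apply/order_o_finite; exists n.+1; apply/(diesP niceH).
exists (fun j => if j is i.+1 then w i else - c); split=> // [|[|j] nj] //.
  by rewrite linearN /= -/d0 -/d1 -vE w0 opprB subrK.
by apply: wn; lia.
Qed.
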